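(* Let $\phi$ be the viscosity solution to the Cauchy problem $\partial\phi/\partial t + H(t,x,\nabla\phi)=0$, $\phi(0,y)=\phi_0(y)$. Then at any $(t,x)$ with $t>0$ there exists a unique admissible velocity $v^*=v^*(t,x)$. Moreover, $v^*$ is the unique point of global minimum of the function $$\hat L(v) := L(t,x,v) - \min_{i\in\mathcal I}\,(-H_i + p_i\cdot v),\qquad v\in\mathbb R^d,$$ where $p_i$, $i\in\mathcal I$, are the limit momenta of $\phi$ at $(t,x)$ and $H_i = H(t,x,p_i)$.
   Context: Space is $\mathbb R^d$. The Hamiltonian $H(t,x,p)$ is finite-valued, smooth, and strictly convex in $p$ (for every $(t,x)$ the graph of $H(t,x,\cdot)$ lies above any tangent plane and contains no straight segments). The Lagrangian is $L(t,x,v)=\sup_{p}[p\cdot v-H(t,x,p)]$, possibly taking the value $+\infty$. The maps $p\mapsto\nabla_pH(t,x,p)$ and $v\mapsto\nabla_vL(t,x,v)$ are mutually inverse (Legendre transforms at $(t,x)$). The initial datum $\phi_0$ is smooth. The viscosity solution is given by the Lax--Oleinik formula $$\phi(t,x)=\min_{\gamma:\gamma(t)=x}\Bigl(\phi_0(\gamma(0))+\int_0^tL(s,\gamma(s),\dot\gamma(s))\,ds\Bigr),$$ where the minimum is over absolutely continuous curves $\gamma:[0,t]\to\mathbb R^d$ with $\gamma(t)=x$. A curve attaining the minimum is called a minimizer coming to $(t,x)$. Limit momenta: fix $(t,x)$ and let $\{\gamma_i\}_{i\in\mathcal I}$ be the family of all minimizers coming to $(t,x)$. The index set $\mathcal I$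 may be infinite. The limit momentum carried by $\gamma_i$ is $p_i=\nabla_vL(t,x,\dot\gamma_i(t))$. Equivalently, $p_i=\nabla\phi_i(t,x)$, where $\phi_i$ is the smooth branch of solution corresponding to $\gamma_i$, when such a branch exists. If $\phi$ is differentiable at $(t,x)$, the only limit momentum is $\nabla\phi(t,x)$. It is a standard fact, taken as part of the setting, that minimizers exist and that the set $\{p_i: i\in\mathcal I\}$ is nonempty and compact. Put $H_i=H(t,x,p_i)$. For $v\in\mathbb R^d$ define the set of relevant indices $$I(v)=\{j\in\mathcal I:\ -H_j+p_j\cdot v=\min_{i\in\mathcal I}(-H_i+p_i\cdot v)\}.$$ Admissibility: a velocity $v^*$ is called admissible at $(t,x)$ if the corresponding momentum $p^*=\nabla_vL(t,x,v^* )$ belongs to the convex hull $\mathrm{conv}\{p_j: j\in I(v^* )\}$. *)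

(* Defs.v *)
From HB Require Import structures.
From mathcomp Require Import all_boot all_order all_algebra.
From mathcomp Require Import all_classical all_reals all_analysis.

Set Implicit Arguments.
Unset Strict Implicit.
Unset Printing Implicit Defensive.

Import Order.TTheory GRing.Theory Num.Theory.
Import numFieldNormedType.Exports.

Local Open Scope classical_set_scope.
Local Open Scope ring_scope.

Section FiniteDimensionalAnalysis.
Context {R : realType} {d : nat}.
Local Notation E := 'rV[R]_d.

Definition dot (u v : E) : R := \sum_(i < d) u 0 i * v 0 i.

(* Convex hull as the set of all finite convex combinations. *)
Definition conv_hull (A : set E) : set E :=
  [set x | exists (n : nat) (a : 'I_n -> R) (y : 'I_n -> E),
     [/\ forall i, 0 <= a i, \sum_(i < n) a i = 1, forall i, A (y i)
       & x = \sum_(i < n) a i *: y i]].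

Definition strictly_convex (f : E -> R) : Prop :=
  forall (x y : E) (s : R), x != y -> 0 < s -> s < 1 ->
    f (s *: x + (1 - s) *: y) < s * f x + (1 - s) * f y.

(* Differentiability of an extended-real function at a point: it is finite on a
   neighbourhood of the point, and its finite part is Frechet differentiable. *)
Definition ediff (f : E -> \bar R) (v : E) : Prop :=
  (\forall w \near v, f w \is a fin_num) /\
  differentiable (fun w => fine (f w)) v.

(* Meaningful when [ediff f v] holds. *)
Definition egrad (f : E -> \bar R) (v : E) : E :=
  \row_(i < d) 'D_(delta_mx 0 i) (fun w => fine (f w)) v.

Definition absolutely_continuous_on (a b : R) (g : R -> E) : Prop :=
  forall e : R, 0 < e -> exists2 r : R, 0 < r &
    forall (n : nat) (l u : 'I_n -> R),
      (forall i, [/\ a <= l i, l i <= u i & u i <= b]) ->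
      trivIset setT (fun i => `]l i, u i[%classic) ->
      \sum_(i < n) (u i - l i) < r ->
      \sum_(i < n) `|g (u i) - g (l i)| < e.

(* Curves are total functions of which only the restriction to [0, t] matters,
   so the velocity at the terminal time t is the derivative from the left. *)
Definition left_quotient (g : R -> E) (t h : R) : E :=
  h^-1 *: (g (t + h) - g t).

Definition left_velocity (g : R -> E) (t : R) : E :=
  lim (left_quotient g t h @[h --> 0^'-]).

Definition left_differentiable (g : R -> E) (t : R) : Prop :=
  cvg (left_quotient g t h @[h --> 0^'-]).

Definition global_min (f : E -> \bar R) (v : E) : Prop :=
  forall w, (f v <= f w)%E.

End FiniteDimensionalAnalysis.

(* C^k on a finite-dimensional space: for k > 0, f is differentiable everywhere
   and each of its directional derivatives is C^(k-1). *)
Fixpoint Ck {R : realType} {V : normedModType R} (k : nat) (f : V -> R) : Prop :=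
  if k is k'.+1
  then (forall x, differentiable f x) /\ (forall v, Ck k' ('D_v f))
  else continuous f.

Definition smooth {R : realType} {V : normedModType R} (f : V -> R) : Prop :=
  forall k, Ck k f.

Section HamiltonJacobi.
Context {R : realType} {d : nat}.
Local Notation E := 'rV[R]_d.
Variables (H : R -> E -> E -> R) (phi0 : E -> R).

Definition smooth_hamiltonian : Prop :=
  smooth (fun z : R * E * E => H z.1.1 z.1.2 z.2).

Definition lagrangian (t : R) (x v : E) : \bar R :=
  ereal_sup [set (dot p v - H t x p)%:E | p in [set: E]].

Definition curves_to (t : R) (x : E) : set (R -> E) :=
  [set g | absolutely_continuous_on 0 t g /\ g t = x].

(* The derivative of an absolutely continuous g exists almost everywhere
   on [0, t]. *)
Definition action (t : R) (g : R -> E) : \bar R :=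
  ((phi0 (g 0%R))%:E +
   \int[lebesgue_measure]_(s in `[0%R, t]) lagrangian s (g s) (derive1 g s))%E.

(* The viscosity solution of the Cauchy problem
     d phi/dt + H(t, x, grad phi) = 0,  phi(0, .) = phi0,
   in the form of the Lax-Oleinik formula; the minimum is attained. *)
Definition viscosity_solution (phi : R -> E -> R) : Prop :=
  forall (t : R) (x : E), 0 <= t ->
    (exists2 g, curves_to t x g & action t g = (phi t x)%:E) /\
    (forall g, curves_to t x g -> ((phi t x)%:E <= action t g)%E).

Variables (phi : R -> E -> R) (t : R) (x : E).

(* This is also the index set of the families of limit momenta and of the
   values H_i: a minimizer serves as its own index. *)
Definition minimizers : set (R -> E) :=
  [set g | curves_to t x g /\ action t g = (phi t x)%:E].

Definition limit_momentum (g : R -> E) : E :=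
  egrad (lagrangian t x) (left_velocity g t).

(* The derivatives entering [limit_momentum] exist. *)
Definition carries_limit_momentum (g : R -> E) : Prop :=
  left_differentiable g t /\ ediff (lagrangian t x) (left_velocity g t).

Definition limit_momenta : set E := limit_momentum @` minimizers.

Definition branch_value (v : E) (g : R -> E) : R :=
  - H t x (limit_momentum g) + dot (limit_momentum g) v.

(* [inf] is an attained minimum when [limit_momenta] is nonempty and compact. *)
Definition min_branch_value (v : E) : R := inf (branch_value v @` minimizers).

Definition relevant (v : E) : set (R -> E) :=
  [set g | minimizers g /\ branch_value v g = min_branch_value v].

Definition admissible (v : E) : Prop :=
  ediff (lagrangian t x) v /\
  conv_hull (limit_momentum @` relevant v) (egrad (lagrangian t x) v).

Definition Lhat (v : E) : \bar R :=
  (lagrangian t x v - (min_branch_value v)%:E)%E.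

End HamiltonJacobi.

(* Main.v *)
From HB Require Import structures.
Require Import Defs.
From mathcomp Require Import all_boot all_order all_algebra.
From mathcomp Require Import all_classical all_reals all_analysis.
From mathcomp Require Import ring lra.
Import Order.TTheory GRing.Theory Num.Theory.
Import numFieldNormedType.Exports.
Local Open Scope classical_set_scope.
Local Open Scope ring_scope.

(** Write [h] for [H t x], [L] for its convex conjugate, [K] for the compact
    set of limit momenta, and [m v] for the minimum of [- h q + q . v] over
    [q] in [K].  The function to be minimised is then
      [L v - m v = max_(q in K) (L v - q . v + h q)],
    and, exchanging [min_v] and [max_q], its convex dual is to maximise
    [eta - h p] over the points [(p, eta)] of the convex hull of the graph of
    [h] on [K].  The proof works on the dual side, where an optimum exists
    by plain compactness, and where the optimality conditions are derivatives
    of the finite smooth function [h] and not of [L], which may be infinite.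

    A point of that hull is a family of weights [a] and points [y] of [K], and
    the dual objective is the Jensen gap
      [\sum_i a i * h (y i) - h (\sum_i a i *: y i)].
    The gap attains a maximum among families of [d + 1] members
    ([jensen_gap_maximum]), and this is a maximum among families of [d + 2]
    members as well, because an affine dependence allows one to drop a member
    without lowering the gap ([jensen_gap_reduction], Caratheodory's argument).
    Let [p] be the barycentre of an optimal family, [eta] the corresponding
    mean of [h], and [v] the gradient of [h] at [p].  Moving a little mass
    to an arbitrary [q] in [K] cannot increase the gap, which to first order
    says [- h q + q . v >= - eta + p . v].  Averaging this inequality
    over the family gives an equality, so each [y i] of positive weight
    minimises [- h q + q . v] over [K]: thus [p] lies in the hull of the
    momenta that are relevant for [v] ([balanced_momentum]).

    Two facts of convex duality turn this into the theorem.  If [h] is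
    strictly convex and [v] is a subgradient of [h] at [p], then [L] is finite
    near [v] and differentiable at [v] with gradient [p]
    ([conjugate_ediff]); hence [v] is admissible.  Conversely, if [L] has
    gradient [p] at [v], then [v] is a subgradient of [h] at [p]
    ([ediff_conjugate_subgradient]).  An admissible [v] with momentum [p] is a
    global minimum of [L - m], since [w |-> p . (w - v)] bounds the increase
    of [L] from below and that of [m] from above ([Lhat_global_min]).  Finally
    any other global minimum [w] makes both bounds sharp, so [w] too is a
    subgradient of [h] at [p] ([Lhat_global_min_subgradient]); as [h] is
    differentiable, [w] is its gradient, that is [w = v]. *)

Set Implicit Arguments.
Unset Strict Implicit.
Unset Printing Implicit Defensive.

(** * Continuity and compactness *)

Lemma continuous_sum (R : realType) (T : topologicalType)
    (W : normedModType R) (n : nat) (F : 'I_n -> T -> W) :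
  (forall i, continuous (F i)) -> continuous (fun x => \sum_i F i x).
Proof.
move=> cF; apply: (@continuous_big W 'I_n +%R 0 xpredT) => // -[u v].
exact: cvgD cvg_fst cvg_snd.
Qed.

Lemma continuous_norm_sub (R : realType) (V : normedModType R) (p : V) :
  continuous (fun q : V => `|q - p|).
Proof.
move=> q; apply: (@continuous_comp _ _ _ (fun u => u - p) Num.norm).
  by apply: continuousB => //; exact: cst_continuous.
exact: norm_continuous.
Qed.

Lemma sphere_closed (R : realType) (V : normedModType R) (p : V) (r : R) :
  closed [set q : V | `|q - p| = r].
Proof.
apply: (@preimage_closed V R (fun q => `|q - p|) [set s | s = r]).
  by move=> q _; exact: continuous_norm_sub.
exact: closed_eq.
Qed.

Lemma sphere_compact (R : realType) d (p : 'rV[R]_d) (r : R) :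
  compact [set q : 'rV[R]_d | `|q - p| = r].
Proof.
apply: bounded_closed_compact; last exact: sphere_closed.
  exists (r + `|p|); split; first exact: num_real.
  move=> M rM q /= qr; apply: le_trans (ltW rM).
  by rewrite -qr -{1}(subrK p q) ler_normD.
Qed.

(** * The scalar product and gradients *)

Section Dot.
Context {R : realType} {d : nat}.
Implicit Types u v w : 'rV[R]_d.

Lemma dotC u v : dot u v = dot v u.
Proof. by apply: eq_bigr => i _; rewrite mulrC. Qed.

Lemma dot_is_linear v : linear (dot^~ v : 'rV[R]_d -> R^o).
Proof.
move=> c u w; rewrite /dot scaler_sumr -big_split; apply: eq_bigr => i _ /=.
by rewrite !mxE mulrDl -mulrA.
Qed.

(** Giving the right argument a name lets the scalar product carry a canonical
    linear structure in its left argument. *)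
Definition dotr v : 'rV[R]_d -> R^o := dot^~ v.

HB.instance Definition _ v :=
  GRing.isLinear.Build R 'rV[R]_d R^o _ (dotr v) (dot_is_linear v).

Lemma dotDl u w v : dot (u + w) v = dot u v + dot w v.
Proof. exact: (linearD (dotr v)). Qed.

Lemma dotBl u w v : dot (u - w) v = dot u v - dot w v.
Proof. exact: (linearB (dotr v)). Qed.

Lemma dotZl c u v : dot (c *: u) v = c * dot u v.
Proof. exact: (linearZ_LR (dotr v)). Qed.

Lemma dotBr u w v : dot v (u - w) = dot v u - dot v w.
Proof. by rewrite dotC dotBl !(dotC v). Qed.

Lemma dot_suml n (a : 'I_n -> R) (y : 'I_n -> 'rV[R]_d) v :
  dot (\sum_i a i *: y i) v = \sum_i a i * dot (y i) v.
Proof.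
rewrite -[dot _ v]/(dotr v _) linear_sum.
by apply: eq_bigr => i _; exact: dotZl.
Qed.

Lemma dot_delta i v : dot (delta_mx 0 i) v = v 0 i.
Proof.
rewrite /dot (bigD1 i) //= big1 ?addr0 => [|j /negPf ji].
  by rewrite mxE !eqxx mul1r.
by rewrite mxE eqxx ji mul0r.
Qed.

Lemma dot_self_le0 u : dot u u <= 0 -> u = 0.
Proof.
move=> u_le0; apply/rowP => i; rewrite mxE; apply/eqP; rewrite -sqrf_eq0 expr2.
rewrite eq_le; apply/andP; split; last by rewrite -expr2 sqr_ge0.
apply: le_trans u_le0; rewrite /dot (bigD1 i) //= lerDl.
by apply: sumr_ge0 => j _; rewrite -expr2 sqr_ge0.
Qed.

(** The norm of a row vector is its largest entry in absolute value. *)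
Lemma row_entry_le u i : `|u 0 i| <= `|u|.
Proof.
rewrite [leRHS]/Num.norm /= mx_normrE; apply/bigmax_geP; right.
by exists (0, i).
Qed.

(** The factor [d] comes from comparing the scalar product with the maximum
    norm. *)
Lemma dot_le_norm u v : `|dot u v| <= d%:R * (`|u| * `|v|).
Proof.
apply: le_trans (ler_norm_sum _ _ _) _.
apply: (@le_trans _ _ (\sum_(i < d) `|u| * `|v|)).
  by apply: ler_sum => i _; rewrite normrM ler_pM ?normr_ge0 ?row_entry_le.
by rewrite sumr_const card_ord mulr_natl.
Qed.

Lemma continuous_dotl v : continuous (dot^~ v).
Proof.
apply: continuous_sum => i u.
by apply: continuousM; [exact: coord_continuous|exact: cst_continuous].
Qed.

Definition gradient (f : 'rV[R]_d -> R) (p : 'rV[R]_d) : 'rV[R]_d :=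
  \row_i 'D_(delta_mx 0 i) f p.

Lemma derive_gradient f p u :
  differentiable f p -> 'D_u f p = dot u (gradient f p).
Proof.
move=> df; rewrite deriveE // {1}[u]row_sum_delta linear_sum.
by apply: eq_bigr => i _; rewrite linearZ /= mxE deriveE.
Qed.

(** All first-order conditions below are obtained by bounding a one-sided
    difference quotient along a segment; [s <= 1] keeps the moving point on the
    segment from [p] to [p + u]. *)
Lemma difference_quotient_ge f p u c : differentiable f p ->
  (forall s, 0 < s -> s <= 1 -> s * c <= f (p + s *: u) - f p) ->
  c <= dot u (gradient f p).
Proof.
move=> df quot; rewrite -derive_gradient //.
apply: cvgr_to_ge (cvg_dnbhs_at_right (@diff_derivable _ _ _ f p u df)) _.
near=> s.
have s0 : 0 < s by near: s; exact: nbhs_right_gt.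
rewrite /= [s *: u + p]addrC -[_ *: _]/(s^-1 * _) ler_pdivlMl // quot //.
by near: s; apply: nbhs_right_le.
Unshelve. all: by end_near. Qed.

Lemma difference_quotient_le (f : 'rV[R]_d -> R) p u c : differentiable f p ->
  (forall s, 0 < s -> s <= 1 -> f (p + s *: u) - f p <= s * c) ->
  dot u (gradient f p) <= c.
Proof.
move=> df quot; rewrite -lerN2 -derive_gradient // -deriveN; last first.
  exact: diff_derivable.
have dNf := differentiableN df; rewrite derive_gradient //.
apply: difference_quotient_ge => // s s0 s1.
by rewrite -![(- f) _]/(- (f _)); have := quot s s0 s1; lra.
Qed.

End Dot.

(** * Convex conjugates and subgradients *)

Section Conjugate.
Context {R : realType} {d : nat}.
Local Notation E := 'rV[R]_d.
Implicit Types (h : E -> R) (p q v w : E).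

(** The function [lagrangian H t x] is convertible to [conjugate (H t x)]. *)
Definition conjugate h v : \bar R :=
  ereal_sup [set (dot p v - h p)%:E | p in [set: E]].

Definition subgradient h p v := forall q, h p + dot (q - p) v <= h q.

Lemma conjugate_ge h p v : ((dot p v - h p)%:E <= conjugate h v)%E.
Proof. by apply: ereal_sup_ubound; exists p. Qed.

Lemma conjugate_le h v c :
  (forall p, dot p v - h p <= c) -> (conjugate h v <= c%:E)%E.
Proof. by move=> le_c; apply: ge_ereal_sup => _ [p _ <-]; rewrite lee_fin. Qed.

(** Equality in the inequality of Fenchel and Young characterises subgradients;
    this is one direction, [conjugate_subgradient] the other. *)
Lemma subgradient_conjugate h p v :
  subgradient h p v -> conjugate h v = (dot p v - h p)%:E.
Proof.
move=> sub; apply/eqP; rewrite eq_le conjugate_ge andbT.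
by apply: conjugate_le => q; have := sub q; rewrite dotBl; lra.
Qed.

Lemma conjugate_subgradient h p v :
  (conjugate h v <= (dot p v - h p)%:E)%E -> subgradient h p v.
Proof.
move=> le_pv q; have := le_trans (conjugate_ge h q v) le_pv.
by rewrite lee_fin dotBl; lra.
Qed.

Lemma strictly_convex_segment h p q s : strictly_convex h ->
  q != p -> 0 < s -> s < 1 -> h (p + s *: (q - p)) < h p + s * (h q - h p).
Proof.
move=> cvx qp s0 s1; have := cvx q p s qp s0 s1.
have -> : s *: q + (1 - s) *: p = p + s *: (q - p).
  by rewrite scalerBr scalerBl scale1r addrCA.
by lra.
Qed.

Lemma convex_segment h p q s : strictly_convex h ->
  0 < s -> s <= 1 -> h (p + s *: (q - p)) <= h p + s * (h q - h p).
Proof.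
move=> cvx s0; rewrite le_eqVlt => /predU1P[->|s1].
  by rewrite scale1r mul1r !subrKC.
have [->|qp] := eqVneq q p; first by rewrite !subrr scaler0 mulr0 !addr0.
exact/ltW/strictly_convex_segment.
Qed.

Lemma gradient_subgradient h p : strictly_convex h -> differentiable h p ->
  subgradient h p (gradient h p).
Proof.
move=> cvx dh q.
suff : dot (q - p) (gradient h p) <= h q - h p by lra.
apply: difference_quotient_le => // s s0 s1.
by have := convex_segment p q cvx s0 s1; lra.
Qed.

Lemma subgradient_unique h p v : differentiable h p ->
  subgradient h p v -> v = gradient h p.
Proof.
(* Tested in the direction of the difference of the two slopes, the subgradient
   inequality bounds the square of that difference by zero. *)
move=> dh sub; apply/subr0_eq/dot_self_le0; rewrite dotBr subr_le0.
apply: difference_quotient_ge => // s s0 _.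
have := sub (p + s *: (v - gradient h p)).
by rewrite [_ + _ - p]addrAC subrr add0r dotZl; lra.
Qed.

(** A continuous strictly convex function leaves its tangent plane by a uniform
    amount on a sphere around the point of contact, by compactness. *)
Lemma sphere_gap h p v (r : R) : continuous h -> strictly_convex h ->
  subgradient h p v -> 0 < r ->
  exists2 e, 0 < e &
    forall q, `|q - p| = r -> h p + dot (q - p) v + e <= h q.
Proof.
move=> ch cvx sub r0.
(* In dimension 0 the sphere is empty, and any positive gap will do. *)
have [[q0 q0r]|none] := pselect ([set q : E | `|q - p| = r] !=set0); last first.
  by exists 1 => // q qr; exfalso; apply: none; exists q.
pose g q := h q - dot q v.
have cg : {within [set q : E | `|q - p| = r], continuous g}.
  apply: continuous_subspaceT => q.
  by apply: (@continuousB _ _ _ h (dot^~ v));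
    [exact: ch|exact: continuous_dotl].
have [q1 /set_mem q1r q1min] := compact_EVT_min
  (ex_intro _ q0 q0r) (@sphere_compact R d p r) cg.
exists (g q1 - g p); last first.
  by move=> q qr; have := q1min q (mem_set qr); rewrite /g dotBl; lra.
have q1p : q1 != p by rewrite -subr_eq0 -normr_gt0 q1r.
(* At the midpoint of [p] and [q1] strict convexity makes the gap positive. *)
have half0 : 0 < 2^-1 :> R by lra.
have half1 : 2^-1 < 1 :> R by lra.
have := strictly_convex_segment cvx q1p half0 half1.
have := sub (p + 2^-1 *: (q1 - p)).
by rewrite [_ + _ - p]addrAC subrr add0r dotZl dotBl /g; lra.
Qed.

(** The upper half of differentiability of the conjugate (the lower half is
    [conjugate_ge]).  In the supremum that defines [conjugate h w], the [q]
    within distance [e / C] of [p] contribute an error of at most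
    [e * `|w - v|].  Farther [q] contribute nothing: by convexity the gap on
    the sphere of that radius grows at least linearly outside it, and for [w]
    close to [v] it outweighs the linear term [dot (q - p) (w - v)]. *)
Lemma conjugate_first_order h p v (e : R) : continuous h ->
  strictly_convex h -> subgradient h p v -> 0 < e ->
  exists2 r, 0 < r & forall w, `|w - v| < r ->
    (conjugate h w <= (dot p w - h p + e * `|w - v|)%:E)%E.
Proof.
move=> ch cvx sub e0.
(* The successor keeps the constant positive in dimension 0. *)
pose C : R := d.+1%:R.
have C0 : 0 < C by rewrite ltr0n.
have dot_le u w : dot u w <= C * (`|u| * `|w|).
  apply: le_trans (ler_norm _) (le_trans (dot_le_norm _ _) _).
  by rewrite ler_wpM2r ?mulr_ge0 // ler_nat.
have r0 : 0 < e / C by exact: divr_gt0.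
have [k k0 kP] := sphere_gap ch cvx sub r0.
exists (k / (e / C) / C); first by rewrite !divr_gt0.
move=> w wv; apply: conjugate_le => q.
rewrite ltr_pdivlMr // in wv.
suff : dot (q - p) (w - v) <= h q - h p - dot (q - p) v + e * `|w - v|.
  by rewrite !(dotBl, dotBr); lra.
apply: le_trans (dot_le _ _) _.
have [qr|qr] := leP `|q - p| (e / C).
  apply: (@le_trans _ _ (e * `|w - v|)); last by have := sub q; lra.
  by rewrite mulrA ler_wpM2r // mulrC -ler_pdivlMr.
have n0 : 0 < `|q - p| by exact: lt_trans qr.
(* [p + s *: (q - p)] is where the segment from [p] to [q] meets the sphere. *)
pose s := (e / C) / `|q - p|.
have s0 : 0 < s by exact: divr_gt0.
have s1 : s <= 1 by rewrite ler_pdivrMr // mul1r ltW.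
have := kP (p + s *: (q - p)).
rewrite [_ + _ - p]addrAC subrr add0r normrZ gtr0_norm // divfK ?gt_eqF //.
rewrite dotZl => /(_ erefl) ks; have cs := convex_segment p q cvx s0 s1.
have {cs ks} : k <= s * (h q - h p - dot (q - p) v) by lra.
rewrite /s mulrAC ler_pdivlMr // => kq.
apply: (@le_trans _ _ (h q - h p - dot (q - p) v)); last first.
  by rewrite lerDl mulr_ge0 // ltW.
rewrite -(ler_pM2l r0); apply: le_trans kq.
rewrite ltr_pdivlMr // in wv.
have -> : e / C * (C * (`|q - p| * `|w - v|)) =
  `|w - v| * C * (e / C) * `|q - p| by ring.
by rewrite ler_pM2r // ltW.
Qed.

(** Strict convexity of a function is smoothness of its conjugate; the gradient
    of the conjugate inverts the subgradient relation. *)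
Lemma conjugate_ediff h p v : continuous h -> strictly_convex h ->
  subgradient h p v -> ediff (conjugate h) v /\ egrad (conjugate h) v = p.
Proof.
move=> ch cvx sub; set f := fun w => fine (conjugate h w).
have fin w c : (conjugate h w <= c%:E)%E -> conjugate h w \is a fin_num.
  move=> wc; have := conjugate_ge h p w; move: wc.
  by case: (conjugate h w).
have fv : f v = dot p v - h p by rewrite /f (subgradient_conjugate sub).
have expand : f \o shift v = cst (f v) + dotr p +o_ (0 : E) id.
  apply/eqaddoP => e e0; have [r r0 rP] := conjugate_first_order ch cvx sub e0.
  apply: filterS (@nbhs0_lt R E r r0) => u ur.
  have : `|u + v - v| < r by rewrite addrK.
  move=> /rP wr; have wf := fin _ _ wr.
  have := conjugate_ge h p (u + v); move: wr.
  rewrite -(fineK wf) !lee_fin -/(f (u + v)) addrK => le_u ge_u.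
  rewrite -[X in `|X|]/(f (u + v) - (f v + dot u p)) fv.
  move: le_u ge_u; rewrite !(dotC p) dotDl => le_u ge_u.
  have eu_ge0 := mulr_ge0 (ltW e0) (normr_ge0 u).
  by rewrite ler_norml; apply/andP; split; lra.
have cont : continuous (dotr p) by exact: continuous_dotl.
have df := diff_unique cont expand.
have dif : differentiable f v by apply/diff_locallyP; rewrite df.
split; last first.
  by apply/rowP => i; rewrite mxE deriveE // df -(dot_delta i).
split => //.
have [r r0 rP] := conjugate_first_order ch cvx sub ltr01.
have near_v : \forall w \near v, `|w - v| < r.
  exact: (@cvgr_distC_lt R E E (nbhs v) _ id v cvg_id r r0).
by apply: filterS near_v => w wv; exact: fin (rP w wv).
Qed.

(** The converse of [conjugate_ediff].  The conjugate lies above its tangent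
    plane at [v]; evaluating this at the gradient [v'] of [h] at [p], where the
    conjugate is known exactly, gives equality in the inequality of Fenchel
    and Young for [p] and [v]. *)
Lemma ediff_conjugate_subgradient h v : strictly_convex h ->
  (forall p, differentiable h p) -> ediff (conjugate h) v ->
  subgradient h (egrad (conjugate h) v) v.
Proof.
move=> cvx dh [finv dif]; set p := egrad _ v.
set f := fun w => fine (conjugate h w) in dif *.
have fv : conjugate h v = (f v)%:E.
  by rewrite /f fineK //; exact: nbhs_singleton finv.
set v' := gradient h p.
have fv' := subgradient_conjugate (gradient_subgradient cvx (dh p)).
have le_f q w c : conjugate h w = c%:E -> dot q w - h q <= c.
  by move=> wc; rewrite -lee_fin -wc conjugate_ge.
apply: conjugate_subgradient; rewrite fv lee_fin.
suff : dot (v' - v) (gradient f v) <= dot p v' - h p - f v.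
  by rewrite -[gradient f v]/p dotBl !(dotC p); lra.
apply: difference_quotient_le => // s s0 s1.
have : (conjugate h (v + s *: (v' - v)) <=
    (f v + s * (dot p v' - h p - f v))%:E)%E.
  apply: conjugate_le => q.
  have qv := le_f q _ _ fv; have qv' := le_f q _ _ fv'.
  rewrite !(dotC q) dotDl dotZl dotBl -!(dotC q).
  have : 0 <= (1 - s) * (f v - (dot q v - h q)) by apply: mulr_ge0; lra.
  have : 0 <= s * (dot p v' - h p - (dot q v' - h q)) by apply: mulr_ge0; lra.
  by lra.
move=> le_c; rewrite /f; move: (conjugate_ge h p (v + s *: (v' - v))) le_c.
case: (conjugate h (v + s *: (v' - v))) => [r| |] //=.
by rewrite !lee_fin /f; lra.
Qed.

End Conjugate.

(** * Maximal Jensen gaps *)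

Section JensenGap.
Context {R : realType} {d : nat}.
Local Notation E := 'rV[R]_d.
Implicit Types (h : E -> R) (K : set E).

Definition weights n (a : 'I_n -> R) : Prop :=
  (forall i, 0 <= a i) /\ \sum_i a i = 1.

Definition jensen_gap h n (a : 'I_n -> R) (y : 'I_n -> E) : R :=
  \sum_i a i * h (y i) - h (\sum_i a i *: y i).

(** A matrix with the [d + 2] rows [(y i, 1)] of length [d + 1] has dependent
    rows; the column of ones makes the coefficients sum to zero. *)
Lemma affine_dependence (y : 'I_d.+2 -> E) : exists c : 'I_d.+2 -> R,
  [/\ exists i, c i != 0, \sum_i c i = 0 & \sum_i c i *: y i = 0].
Proof.
pose M := row_mx (\matrix_i y i) (const_mx 1 : 'cV[R]_d.+2).
have : kermx M != 0.
  rewrite kermx_eq0 /row_free; apply: contraTneq (rank_leq_col M) => ->.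
  by rewrite addn1 ltnn.
case/rowV0Pn => c /sub_kermxP; rewrite mul_mx_row -row_mx0 => /eq_row_mx[cy c1].
move=> c0; exists (c 0); split.
- have [i ci] := rV0Pn _ c0.
  by exists i.
- have /rowP/(_ 0) := c1; rewrite !mxE => c1'.
  by rewrite -[RHS]c1'; apply: eq_bigr => i _; rewrite mxE mulr1.
- rewrite -[RHS]cy mulmx_sum_row; apply: eq_bigr => i _.
  by rewrite rowK.
Qed.

(** Move the weights along an affine dependence [c] of the points, which keeps
    their barycentre, in the direction that does not decrease the mean of [h],
    until the first weight vanishes; then drop that point. *)
Lemma jensen_gap_reduction h (a : 'I_d.+2 -> R) (y : 'I_d.+2 -> E) :
  weights a -> exists (b : 'I_d.+1 -> R) (f : 'I_d.+1 -> 'I_d.+2),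
    weights b /\ jensen_gap h a y <= jensen_gap h b (y \o f).
Proof.
move=> [a0 a1].
have [c [[k ck] c1 cy ch]] : exists c : 'I_d.+2 -> R,
    [/\ exists i, c i != 0, \sum_i c i = 0, \sum_i c i *: y i = 0
      & 0 <= \sum_i c i * h (y i)].
  have [c [[k ck] c1 cy]] := affine_dependence y.
  (* Either [c] or its opposite has the required sign. *)
  have [ch|ch] := leP 0 (\sum_i c i * h (y i)).
    by exists c; split => //; exists k.
  exists (fun i => - c i); split; first by exists k; rewrite oppr_eq0.
  - by rewrite sumrN c1 oppr0.
  - by under eq_bigr do rewrite scaleNr; rewrite sumrN cy oppr0.
  - by under eq_bigr do rewrite mulNr; rewrite sumrN oppr_ge0 ltW.
have [i0 ci0] : exists i, c i < 0.
  apply/not_existsP => cge0; have {}cge0 i : 0 <= c i.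
    by rewrite leNgt; apply/negP/cge0.
  by move: ck; rewrite (psumr_eq0P (fun i _ => cge0 i) c1) // eqxx.
pose ratio i := a i / - c i.
have [i ci imin] : exists2 i, c i < 0 & forall j, c j < 0 -> ratio i <= ratio j.
  have [i ci rmin] := @arg_minP _ _ _ i0 [pred i | c i < 0] ratio ci0.
  by exists i.
(* [s] is the first time at which one of the moving weights [b] vanishes. *)
pose s := ratio i; pose b j := a j + s * c j.
have s0 : 0 <= s by rewrite divr_ge0 // oppr_ge0 ltW.
have bi : b i = 0.
  by rewrite /b /s /ratio invrN mulrN mulNr divfK ?subrr // (lt_eqF ci).
have b0 j : 0 <= b j.
  have [cj|cj] := leP 0 (c j); first exact: addr_ge0 (a0 j) (mulr_ge0 s0 cj).
  have := imin j cj; rewrite -/s /ratio ler_pdivlMr ?oppr_gt0 // /b; lra.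
(* Dropping the index [i] does not change sums weighted by [b]. *)
have sumb (V : lmodType R) (F : 'I_d.+2 -> V) :
    \sum_j b (lift i j) *: F (lift i j) =
    \sum_j a j *: F j + s *: \sum_j c j *: F j.
  rewrite scaler_sumr -big_split /=; transitivity (\sum_j b j *: F j).
    by rewrite [RHS](bigD1_ord i) //= bi scale0r add0r.
  by apply: eq_bigr => j _; rewrite scalerDl scalerA.
exists (b \o lift i), (lift i); split.
  split=> [j|]; first exact: b0.
  have := sumb R^o (fun=> 1); rewrite -!scaler_suml a1 c1 scale0r scaler0 addr0.
  by rewrite -![_ *: 1]/(_ * 1) !mulr1.
have hb : \sum_j b (lift i j) * h (y (lift i j)) =
    \sum_j a j * h (y j) + s * \sum_j c j * h (y j).
  exact: (sumb R^o (h \o y)).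
by rewrite /jensen_gap /= hb sumb cy scaler0 addr0 lerB // lerDl mulr_ge0.
Qed.

(** Encoding a family as a function into pairs (weight, point) makes it a point
    of a compact product, on which the weights sum to one on a closed set. *)
Lemma jensen_gap_maximum h K n : continuous h -> compact K -> K !=set0 ->
  exists (a : 'I_n.+1 -> R) (y : 'I_n.+1 -> E),
    [/\ weights a, forall i, K (y i) &
      forall (b : 'I_n.+1 -> R) z, weights b -> (forall i, K (z i)) ->
        jensen_gap h b z <= jensen_gap h a y].
Proof.
move=> ch cK [q Kq].
pose T := prod_topology (fun _ : 'I_n.+1 => (R * E)%type).
pose box : set T := [set f | forall i, (`[0, 1]%classic `*` K) (f i)].
pose total (f : T) : R := \sum_i (f i).1.
pose simplex : set T := total @^-1` [set x | x = 1].
pose G (f : T) := jensen_gap h (fun i => (f i).1) (fun i => (f i).2).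
have cproj i : continuous (fun f : T => f i) := @proj_continuous _ _ i.
have c1 i : continuous (fun f : T => (f i).1).
  by move=> f; apply: continuous_comp (cproj i f) _; exact: cvg_fst.
have c2 i : continuous (fun f : T => (f i).2).
  by move=> f; apply: continuous_comp (cproj i f) _; exact: cvg_snd.
have ctotal : continuous total by exact: continuous_sum.
have cG : continuous G.
  move=> f; apply: (@continuousB R R T (fun f : T => \sum_i (f i).1 * h (f i).2)
    (fun f : T => h (\sum_i (f i).1 *: (f i).2))).
    apply: continuous_sum => i {}f.
    apply: (@continuousM R T (fun f : T => (f i).1)
      (fun f : T => h (f i).2)); first exact: c1.
    by apply: continuous_comp (c2 i f) _; exact: ch.
  apply: (@continuous_comp _ _ _
    (fun f : T => \sum_i (f i).1 *: (f i).2) h); last exact: ch.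
  apply: continuous_sum => i {}f.
    apply: (@continuousZ R E T (fun f : T => (f i).1)
    (fun f : T => (f i).2)); [exact: c1|exact: c2].
have cbox : compact (box `&` simplex).
  apply: compact_closedI.
    apply: (@tychonoff _ (fun=> (R * E)%type)
      (fun=> `[0, 1]%classic `*` K)) => i.
    by apply: compact_setX => //; exact: segment_compact.
  apply: (@preimage_closed T R total [set x | x = 1]); last exact: closed_eq.
  by move=> f _; exact: ctotal.
have [|f /set_mem[fbox fsum] fmax] := compact_EVT_max _ cbox
    (continuous_subspaceT cG).
  exists (fun i => ((if i == ord0 then 1 else 0), q)); split.
    move=> i /=; split => //=; rewrite in_itv /=.
    by case: ifP; rewrite ?lexx ?ler01.
  rewrite /simplex /total /= (bigD1 ord0) //= big1 ?addr0 // => i /negPf ->.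
  by [].
exists (fun i => (f i).1), (fun i => (f i).2); split.
- split=> [i|]; last exact: fsum.
  by have [/= /itvP->] := fbox i.
- by move=> i; have [] := fbox i.
move=> b z [b0 b1] Kz; apply: (fmax (fun i => (b i, z i))).
apply/mem_set; split => [i|]; last exact: b1.
split => //=; rewrite in_itv /= b0 -b1 (bigD1 i) //= lerDl.
exact: sumr_ge0.
Qed.

(** First-order optimality of a family with maximal Jensen gap.  With [p] its
    barycentre and [eta] the mean of [h], shifting mass [s] to a point [q] of
    [K] gives [h q - eta <= dot (q - p) (gradient h p)]; averaged over the
    family this is an equality, hence it is an equality at each point of
    positive weight. *)
Lemma balanced_momentum h K : (forall p, differentiable h p) ->
  compact K -> K !=set0 ->
  exists p, conv_hull [set q | K q /\ forall q', K q' ->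
    - h q + dot q (gradient h p) <= - h q' + dot q' (gradient h p)] p.
Proof.
move=> dh cK K0.
have ch : continuous h by move=> p; exact: differentiable_continuous.
have [a [y [[a0 a1] Ky gapmax]]] := @jensen_gap_maximum h K d ch cK K0.
set p := \sum_i a i *: y i; exists p; set v := gradient h p.
pose eta := \sum_i a i * h (y i).
have first_order q : K q -> h q - eta <= dot (q - p) v.
  move=> Kq; apply: difference_quotient_ge => // s s0 s1.
  (* The index [ord0] stands for the new point [q]. *)
  pose b (i : 'I_d.+2) := if unlift ord0 i is Some j then (1 - s) * a j else s.
  pose z (i : 'I_d.+2) := if unlift ord0 i is Some j then y j else q.
  have wb : weights b.
    split=> [i|].
      rewrite /b; case: unliftP => [j _|_]; last exact: ltW.
      by rewrite mulr_ge0 ?subr_ge0.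
    rewrite big_ord_recl /b unlift_none.
    under eq_bigr do rewrite liftK.
    by rewrite -mulr_sumr a1 mulr1 addrC subrK.
  have Kz i : K (z i) by rewrite /z; case: unliftP.
  have [b' [f [wb' le_gap]]] := jensen_gap_reduction h z wb.
  have hull : \sum_i b i *: z i = p + s *: (q - p).
    rewrite big_ord_recl /b /z unlift_none.
    under eq_bigr do rewrite liftK -scalerA.
    by rewrite -scaler_sumr -/p scalerBr scalerBl scale1r addrCA.
  have values : \sum_i b i * h (z i) = s * h q + (1 - s) * eta.
    rewrite big_ord_recl /b /z unlift_none.
    under eq_bigr do rewrite liftK -mulrA.
    by rewrite -mulr_sumr.
  have := le_trans le_gap (gapmax _ _ wb' (fun i => Kz (f i))).
  by rewrite /jensen_gap hull values -/eta -/p; lra.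
pose slack i := a i * ((eta - dot p v) - (h (y i) - dot (y i) v)).
have slack_ge0 i : 0 <= slack i.
  apply: mulr_ge0 (a0 i) _.
  by have := first_order _ (Ky i); rewrite dotBl; lra.
have slack_sum : \sum_i slack i = 0.
  under eq_bigr do rewrite /slack mulrBr.
  rewrite sumrB -mulr_suml a1 mul1r.
  under eq_bigr do rewrite mulrBr.
  by rewrite sumrB -/eta -dot_suml -/p subrr.
have slack0 i : slack i = 0.
  by apply: (psumr_eq0P (fun i _ => slack_ge0 i) slack_sum).
have [k ak] : exists k, a k != 0.
  apply/not_existsP => none; move: a1; rewrite big1 => [/eqP|i _].
    by rewrite eq_sym oner_eq0.
  exact/eqP/negPn/negP/none.
(* A convex combination must consist of minimisers only, so the points of
   weight zero are replaced by one of positive weight. *)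
pose y' i := if a i == 0 then y k else y i.
have relevant i : a i != 0 -> K (y i) /\ forall q', K q' ->
    - h (y i) + dot (y i) v <= - h q' + dot q' v.
  move=> ai; split => // q' Kq'.
  have /eqP := slack0 i; rewrite mulf_eq0 (negPf ai) /= => /eqP.
  by have := first_order _ Kq'; rewrite dotBl; lra.
exists d.+1, a, y'; split => //.
  by move=> i; rewrite /y' /=; case: ifPn => [_|]; exact: relevant.
apply: eq_bigr => i _; rewrite /y'; case: eqP => // ->.
by rewrite !scale0r.
Qed.

End JensenGap.

(** * Admissible velocities and global minima *)

Lemma smooth_hamiltonian_differentiable (R : realType) (d : nat)
    (H : R -> 'rV[R]_d -> 'rV[R]_d -> R) t x p :
  smooth_hamiltonian H -> differentiable (H t x) p.
Proof.
move=> /(_ 1)[dH _].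
apply: (@differentiable_comp R _ _ _ (fun q => (t, x, q))
  (fun z : R * 'rV[R]_d * 'rV[R]_d => H z.1.1 z.1.2 z.2)); last exact: dH.
apply: differentiable_pair; last exact: ex_diff.
exact: differentiable_cst.
Qed.

Section Branches.
Context {R : realType} {d : nat}.
Local Notation E := 'rV[R]_d.
Variables (H : R -> E -> E -> R) (phi0 : E -> R) (phi : R -> E -> R).
Variables (t : R) (x : E).
Local Notation lm := (limit_momentum H t x).
Local Notation m := (min_branch_value H phi0 phi t x).

Lemma min_branch_value_le v g :
  continuous (H t x) -> compact (limit_momenta H phi0 phi t x) ->
  minimizers H phi0 phi t x g ->
  m v <= branch_value H t x v g.
Proof.
move=> H_cont K_compact mg; pose f p := - H t x p + dot p v.
have cf : {within limit_momenta H phi0 phi t x, continuous f}.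
  apply: continuous_subspaceT => p.
  apply: (@continuousD _ _ _ (fun p => - H t x p) (dot^~ v)).
    by apply: (@continuousN _ _ _ (H t x)); exact: H_cont.
  exact: continuous_dotl.
have K0 : limit_momenta H phi0 phi t x !=set0 by exists (lm g), g.
have [c _ cmin] := compact_EVT_min K0 K_compact cf.
apply: ge_inf; last by exists g.
exists (f c) => _ [g' mg' <-]; apply: (cmin (lm g')).
by apply/mem_set; exists g'.
Qed.

Lemma min_branch_value_attained v g :
  continuous (H t x) -> compact (limit_momenta H phi0 phi t x) ->
  minimizers H phi0 phi t x g ->
  (forall g', minimizers H phi0 phi t x g' ->
     branch_value H t x v g <= branch_value H t x v g') ->
  m v = branch_value H t x v g.
Proof.
move=> H_cont K_compact mg gmin; apply/eqP.
rewrite eq_le min_branch_value_le //=.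
apply: lb_le_inf; first by exists (branch_value H t x v g), g.
by move=> _ [g' mg' <-]; exact: gmin.
Qed.

(** [m] is a minimum of affine functions, and the relevant momenta are the
    slopes of those that attain the minimum at [v]; hence every convex
    combination of them is a supergradient of [m] at [v]. *)
Lemma conv_hull_relevant_le v w p :
  continuous (H t x) -> compact (limit_momenta H phi0 phi t x) ->
  conv_hull (lm @` relevant H phi0 phi t x v) p ->
  m w <= m v + dot p (w - v).
Proof.
move=> H_cont K_compact [n [a [y [a0 a1 yr ->]]]].
rewrite dot_suml -[m v]mul1r -[m w]mul1r -a1 !mulr_suml -big_split /=.
apply: ler_sum => i _; rewrite -mulrDr ler_wpM2l //.
have [g [mg gv] <-] := yr i.
have := min_branch_value_le w H_cont K_compact mg.
by rewrite -gv /branch_value dotBr; lra.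
Qed.

Lemma Lhat_global_min v p :
  continuous (H t x) -> compact (limit_momenta H phi0 phi t x) ->
  subgradient (H t x) p v ->
  conv_hull (lm @` relevant H phi0 phi t x v) p ->
  global_min (Lhat H phi0 phi t x) v.
Proof.
move=> H_cont K_compact sub hull w.
have := conv_hull_relevant_le w H_cont K_compact hull.
have := conjugate_ge (H t x) p w.
rewrite /Lhat -![lagrangian H t x _]/(conjugate (H t x) _).
rewrite (subgradient_conjugate sub).
case: (conjugate (H t x) w) => [r| |] //=; last by move=> _ _; exact: leey.
by rewrite -!EFinB !lee_fin dotBr; lra.
Qed.

(** At a second global minimum [w] the bounds that prove [Lhat_global_min] are
    equalities, and equality for the conjugate says that [w] is a subgradient
    at the same [p]. *)
Lemma Lhat_global_min_subgradient v p w :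
  continuous (H t x) -> compact (limit_momenta H phi0 phi t x) ->
  subgradient (H t x) p v ->
  conv_hull (lm @` relevant H phi0 phi t x v) p ->
  global_min (Lhat H phi0 phi t x) w -> subgradient (H t x) p w.
Proof.
move=> H_cont K_compact sub hull /(_ v).
have := conv_hull_relevant_le w H_cont K_compact hull.
have := conjugate_ge (H t x) p w.
have := @conjugate_subgradient R d (H t x) p w.
rewrite /Lhat -![lagrangian H t x _]/(conjugate (H t x) _).
rewrite (subgradient_conjugate sub).
case: (conjugate (H t x) w) => [r| |] //= imp.
rewrite -!EFinB !lee_fin dotBr => ? ? ?.
by apply: imp; rewrite lee_fin; lra.
Qed.

End Branches.

Theorem theorem1 (R : realType) (d : nat)
  (H : R -> 'rV[R]_d -> 'rV[R]_d -> R) (phi0 : 'rV[R]_d -> R)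
  (phi : R -> 'rV[R]_d -> R)
  (H_smooth : smooth_hamiltonian H)
  (H_convex : forall (t : R) (x : 'rV[R]_d), 0 <= t -> strictly_convex (H t x))
  (phi0_smooth : smooth phi0)
  (phi_solution : viscosity_solution H phi0 phi)
  (t : R) (x : 'rV[R]_d) (t_gt0 : 0 < t)
  (momenta_exist : forall g, minimizers H phi0 phi t x g ->
     carries_limit_momentum H t x g)
  (momenta_nonempty : limit_momenta H phi0 phi t x !=set0)
  (momenta_compact : compact (limit_momenta H phi0 phi t x)) :
  exists vstar : 'rV[R]_d,
    unique (admissible H phi0 phi t x) vstar /\
    unique (global_min (Lhat H phi0 phi t x)) vstar.
Proof.
have cvx := H_convex t x (ltW t_gt0).
have dH p : differentiable (H t x) p.
  exact: smooth_hamiltonian_differentiable.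
have cH : continuous (H t x) by move=> p; exact: differentiable_continuous.
have [p hull] := balanced_momentum dH momenta_compact momenta_nonempty.
set v := gradient (H t x) p in hull; exists v.
have sub : subgradient (H t x) p v by exact: gradient_subgradient.
have [difL gradL] := conjugate_ediff cH cvx sub.
have {}hull : conv_hull (limit_momentum H t x @` relevant H phi0 phi t x v) p.
  have [n [a [y [a0 a1 yr py]]]] := hull; exists n, a, y; split => // i.
  have [[g mg gy] ymin] := yr i; exists g => //; split => //.
  apply/esym/(min_branch_value_attained cH momenta_compact mg) => g' mg'.
  by rewrite /branch_value gy; apply: ymin; exists g'.
have adm : admissible H phi0 phi t x v.
  split; first exact: difL.
  by rewrite -[egrad _ v]/(egrad (conjugate (H t x)) v) gradL.
have glob w : admissible H phi0 phi t x w -> global_min (Lhat H phi0 phi t x) w.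
  move=> [difw]; apply: (Lhat_global_min cH momenta_compact).
  exact: ediff_conjugate_subgradient.
have uniq w : global_min (Lhat H phi0 phi t x) w -> v = w.
  move=> gw; rewrite [RHS](@subgradient_unique _ _ (H t x) p) //.
  exact: (Lhat_global_min_subgradient cH momenta_compact sub hull gw).
split; split => //; first by move=> w /glob; exact: uniq.
exact: glob.
Qed.
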